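(* Let $Q$ be a probability measure on $\mathbb Z^{\ge0}$, let $\tilde Q$ be the least concave majorant of $Q$, let $\tilde Q^a$ be the absolutely continuous part of $\tilde Q$ with respect to $Q$, and let $n\ge1$. Then the product measure $(\tilde Q^a)^n$ is the reverse information projection of $Q^n$ onto $\mathcal M^n_{\mathrm{iid}}=\{P^n:P\in\mathcal M\}$; and the e-value for $\mathcal M^n_{\mathrm{iid}}$ $$E_Q^*(x_1,\dots,x_n)=\prod_{k=1}^n\frac{f_Q(x_k)}{f_{\tilde Q}(x_k)}$$ (where $0/0$ is understood as $0$) has the largest e-power under $Q^n$, i.e. it attains the maximum of $\mathbb E_{Q^n}\log E(X_1,\dots,X_n)$ over all e-values $E$ for $\mathcal M^n_{\mathrm{iid}}$.
   Context: $\mathbb Z^{\ge0}=\{0,1,2,\dots\}$; $f_P(n)=P(\{n\})$ and $F_P(n)=P((-\infty,n])$ denote the mass function and CDF of $P$; $P^n$ is the $n$-fold product measure. $\mathcal M$ is the set of probability measures $P$ on $\mathbb Z^{\ge0}$ with $f_P(n)\ge f_P(n+1)$ for all $n\in\mathbb Z^{\ge0}$. The least concave majorant of $Q$ is the probability measure $\tilde Q$ on $\mathbb Z^{\ge0}$ whose CDF $F_{\tilde Q}$ is the smallest concave function majorizing $F_Q$, concavity being understood on $\{-1,0,1,2,\dots\}$ with $F_Q(-1)=F_{\tilde Q}(-1)=0$. $\tilde Q^a$ has mass function $f_{\tilde Q}(n)\mathbf 1_{\{f_Q(n)>0\}}$. For a set $\mathcal A$ of measures on a measurable space $\mathbb A$,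 the polar $\mathcal A^\circ$ is the set of measurable $f:\mathbb A\to[0,\infty)$ with $\sup_{P\in\mathcal A}\int f\,dP\le1$ (for probabilities these are exactly the e-values for $\mathcal A$), and the bipolar ${}^\circ(\mathcal A^\circ)$ is the set of $\sigma$-finite measures $P$ with $\sup_{f\in\mathcal A^\circ}\int f\,dP\le1$. For a class $\mathcal A$ of probabilities and a probability $R$ with $R\ll\mathcal A$ (every set null under all $P\in\mathcal A$ is $R$-null), the numeraire is the $R$-a.s. unique, $R$-a.s. positive $E^*\in\mathcal A^\circ$ such that $\mathbb E_R\log\frac{E}{E^*}\in[-\infty,0]$ for all $E\in\mathcal A^\circ$, and the reverse information projection of $R$ onto $\mathcal A$ is the measure $P^*$ defined by $dP^*/dR=1/E^*$. Equivalently (Larsson, Ramdas and Ruf), $P^*$ is the unique measure in ${}^\circ(\mathcal A^\circ)$ that is mutually absolutely continuous with $R$ and for which some version of $dR/dP^*$ belongs to $\mathcal A^\circ$. Convention: $\mathbb E_R\log g=-\infty$ whenever $\mathbb E_R(\log g)^-=\infty$. *)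

(* Defs.v *)
From HB Require Import structures.
From mathcomp Require Import all_boot all_order all_algebra.
From mathcomp Require Import all_classical all_reals all_analysis.

Set Implicit Arguments.
Unset Strict Implicit.
Unset Printing Implicit Defensive.

Import Order.TTheory GRing.Theory Num.Theory.
Import numFieldNormedType.Exports.

Local Open Scope classical_set_scope.
Local Open Scope ring_scope.
Local Open Scope ereal_scope.

Section product_power.
Context (d : measure_display) (T : measurableType d) (R : realType).

Definition tuple_cons n (x : T * n.-tuple T) : n.+1.-tuple T :=
  [tuple of x.1 :: x.2].

Lemma measurable_tuple_cons n : measurable_fun setT (@tuple_cons n).
Proof. by apply: measurable_cons. Qed.

Section cons_measure.
Variables (n : nat) (mu : {finite_measure set T -> \bar R})
  (nu : {finite_measure set (n.-tuple T) -> \bar R}).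

Definition cons_measure : set (n.+1.-tuple T) -> \bar R :=
  pushforward (mu \x nu) (@tuple_cons n).

Let measurable_tuple_consV A :
  measurable A -> measurable (@tuple_cons n @^-1` A).
Proof.
by move=> mA; rewrite -[X in measurable X]setTI; exact: measurable_tuple_cons.
Qed.

Let cons_measure0 : cons_measure set0 = 0.
Proof. by rewrite /cons_measure /pushforward preimage_set0 measure0. Qed.

Let cons_measure_ge0 A : 0 <= cons_measure A.
Proof. by apply: integral_ge0 => x _; exact: measure_ge0. Qed.

Let cons_measure_sigma_additive : semi_sigma_additive cons_measure.
Proof.
move=> F mF tF mUF; rewrite /cons_measure /pushforward preimage_bigcup.
apply: measure_semi_sigma_additive.
- by move=> i; exact: measurable_tuple_consV.
- apply/trivIsetP => /= i j _ _ ij; rewrite -preimage_setI.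
  by move/trivIsetP : tF => /(_ _ _ _ _ ij) ->//; rewrite preimage_set0.
- by rewrite -preimage_bigcup; exact: measurable_tuple_consV.
Qed.

HB.instance Definition _ := isMeasure.Build _ _ _ cons_measure
  cons_measure0 cons_measure_ge0 cons_measure_sigma_additive.

Let cons_measure_fin : fin_num_fun cons_measure.
Proof.
apply: lty_fin_num_fun => /=.
rewrite (_ : cons_measure setT = (mu \x nu) (setT `*` setT)); last first.
  by rewrite setXTT.
by rewrite product_measure1E// lte_mul_pinfty ?fin_num_measure// ltey_eq
  fin_num_measure.
Qed.

HB.instance Definition _ := Measure_isFinite.Build _ _ _ cons_measure
  cons_measure_fin.

End cons_measure.

(* The n-fold product measure mu^n, on n.-tuple T with its product
   sigma-algebra; power_measure_box below characterizes it. *)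
Fixpoint power_measure (mu : {finite_measure set T -> \bar R}) (n : nat) :
    {finite_measure set (n.-tuple T) -> \bar R} :=
  if n is m.+1 then cons_measure mu (power_measure mu m)
  else dirac ([tuple] : 0.-tuple T).

Lemma power_measure_box (mu : {finite_measure set T -> \bar R}) (n : nat)
    (A : 'I_n -> set T) : (forall i, measurable (A i)) ->
  power_measure mu n [set x | forall i, A i (tnth x i)] = \prod_(i < n) mu (A i).
Proof.
elim: n A => [|n IH] A mA.
  by rewrite big_ord0 /= diracE mem_set// => -[].
rewrite big_ord_recl -IH//= /cons_measure /pushforward.
have mtl : measurable
    [set x : n.-tuple T | forall i, A (lift ord0 i) (tnth x i)].
  rewrite [X in measurable X](_ : _ =
      \bigcap_(i in [set: 'I_n]) ((@tnth n T)^~ i @^-1` A (lift ord0 i))).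
    apply: fin_bigcap_measurable => // i _.
    by rewrite -[X in measurable X]setTI; apply: measurable_tnth.
  by apply/seteqP; split => x /= h i => [_|]; exact: h.
rewrite -product_measure1E//; congr (_ _).
apply/seteqP; split => -[x t] /=.
  move=> h; split; first exact: h ord0.
  by move=> i; have := h (lift ord0 i); rewrite tnthS.
move=> [h0 h] i; have [j ->|->] := unliftP ord0 i; last exact: h0.
by rewrite tnthS.
Qed.

End product_power.

Section e_values.
Context (d : measure_display) (T : measurableType d) (R : realType).
Implicit Types (A : set {measure set T -> \bar R}).

Definition polar A : set (T -> R) :=
  [set f : T -> R | [/\ measurable_fun setT f, (forall x, (0 <= f x)%R) &
     ereal_sup [set \int[P]_x (f x)%:E | P in A] <= 1]].

(* lne maps 0 to -oo. *)
Definition elog_mean (Q : {measure set T -> \bar R}) (g : T -> R) : \bar R :=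
  let log_g := fun x => lne (g x)%:E in
  if \int[Q]_x (log_g^\- x) == +oo then -oo else \int[Q]_x log_g x.

Definition dominated_by A (Q : {measure set T -> \bar R}) : Prop :=
  forall N, measurable N ->
    (forall P : {measure set T -> \bar R}, A P -> P N = 0) -> Q N = 0.

Definition numeraire_property A (Q : {measure set T -> \bar R})
    (E : T -> R) : Prop :=
  [/\ polar A E, {ae Q, forall x, (0 < E x)%R} &
      forall E', polar A E' -> elog_mean Q (fun x => E' x / E x)%R <= 0].

Definition is_numeraire A (Q : {measure set T -> \bar R})
    (E : T -> R) : Prop :=
  numeraire_property A Q E /\
  (forall E', numeraire_property A Q E' -> {ae Q, forall x, E' x = E x}).

(* Pstar is the measure with density 1 / E with respect to Q, for the
   numeraire E; the value of E^-1 where E = 0 is irrelevant. *)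
Definition is_reverse_information_projection A
    (Q Pstar : {measure set T -> \bar R}) : Prop :=
  dominated_by A Q /\
  exists2 E, is_numeraire A Q E &
    forall B, measurable B -> Pstar B = \int[Q]_(x in B) ((E x)^-1)%:E.

End e_values.

Section integer_measures.
Context (R : realType).

Definition mass (P : {measure set nat -> \bar R}) (n : nat) : R :=
  fine (P [set n]).

(* The CDF is indexed by the integers so as to be defined at -1. *)
Definition cdf (P : {measure set nat -> \bar R}) (z : int) : R :=
  fine (P [set k : nat | (k%:Z <= z)%R]).

Definition decreasing_probabilities : set (probability nat R) :=
  [set P | forall n, (mass P n.+1 <= mass P n)%R].

Definition decreasing_iid (n : nat) :
    set {measure set (n.-tuple nat) -> \bar R} :=
  [set (power_measure P n : {measure set (n.-tuple nat) -> \bar R})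
     | P in decreasing_probabilities].

(* Concavity on {-1, 0, 1, ...}; values below -1 play no role. *)
Definition discrete_concave (G : int -> R) : Prop :=
  forall a b c : int, (-1 <= a)%R -> (a <= b)%R -> (b <= c)%R ->
    ((c - b)%:~R * G a + (b - a)%:~R * G c <= (c - a)%:~R * G b)%R.

Definition majorizes (G F : int -> R) : Prop :=
  forall z : int, (-1 <= z)%R -> (F z <= G z)%R.

Definition is_least_concave_majorant (Q Qt : probability nat R) : Prop :=
  [/\ discrete_concave (cdf Qt), majorizes (cdf Qt) (cdf Q) &
      forall G, discrete_concave G -> majorizes G (cdf Q) ->
        majorizes G (cdf Qt)].

Lemma measurable_atoms (Q : probability nat R) :
  measurable [set n | (0 < mass Q n)%R].
Proof. by []. Qed.

Lemma atoms_ltoo (Q Qt : probability nat R) :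
  Qt [set n | (0 < mass Q n)%R] < +oo.
Proof. by rewrite -ge0_fin_numE// fin_num_measure. Qed.

Definition ac_part (Q Qt : probability nat R) :
    {finite_measure set nat -> \bar R} :=
  mfrestr (measurable_atoms Q) (atoms_ltoo Q Qt).

Lemma mass_ac_part (Q Qt : probability nat R) n :
  mass (ac_part Q Qt) n = (mass Qt n * (0 < mass Q n)%R%:R)%R.
Proof.
rewrite /mass /= /mfrestr /mrestr -/(mass Q n).
have [Qn|Qn] := boolP (0 < mass Q n)%R.
  by rewrite mulr1 (_ : _ `&` _ = [set n])//; apply/setIidPl => _ ->.
rewrite mulr0 (_ : _ `&` _ = set0) ?measure0//.
by apply/seteqP; split => // k /= [-> h]; rewrite h in Qn.
Qed.

(* Division by 0 is 0 in R, so 0 / 0 = 0. *)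
Definition optimal_evalue (Q Qt : probability nat R) (n : nat)
    (x : n.-tuple nat) : R :=
  (\prod_(k < n) (mass Q (tnth x k) / mass Qt (tnth x k)))%R.

End integer_measures.

Arguments decreasing_iid : clear implicits.

(* Main.v *)
(* Write [q], [p], [F], [G] for the mass functions and CDFs of [Q] and [Qt].
   The slope [p] of [G] can only drop at an index where [G] touches [F], so
   summation by parts gives [\sum_(j <= m) (q j / p j - 1) =
   (F m - G m) / p m <= 0]; a second summation by parts against a
   nonincreasing mass function shows that [q / p] is an e-value for the
   decreasing distributions, and Fubini passes to n-fold products.

   Conversely, for any e-value [E] of the product class, the Q^n-integral of
   [E / E*] is the integral of [E] against the absolutely continuous part of
   Qt^n, hence at most 1 because [Qt] is itself decreasing.  This bound alone
   makes [E*] log-optimal and the unique numeraire. *)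

From mathcomp Require Import all_boot all_order all_algebra.
From mathcomp Require Import all_classical all_reals all_analysis.
From mathcomp Require Import measurable_realfun zify ring lra.
Require Import Defs.

Set Implicit Arguments.
Unset Strict Implicit.
Unset Printing Implicit Defensive.

Import Order.TTheory GRing.Theory Num.Theory.

Local Open Scope classical_set_scope.
Local Open Scope ring_scope.

(** * The least concave majorant *)

Section majorant.
Context {R : realType}.
Implicit Types P Q Qt : probability nat R.

Lemma mass_ge0 P k : 0 <= mass P k.
Proof. exact: fine_ge0. Qed.

Lemma mass_EFin P k : (mass P k)%:E = P [set k].
Proof. by rewrite /mass fineK// fin_num_measure. Qed.

Lemma cdf_rec P (k : nat) : cdf P k = cdf P (k%:Z - 1) + mass P k.
Proof.
rewrite /cdf /mass -fineD ?fin_num_measure//; congr fine.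
rewrite -measureU//; last by apply/seteqP; split => // j /= [jk e]; lia.
congr (P _); apply/seteqP; split => j /=; last by case => [|e]; lia.
have [->|jk] := eqVneq j k; first by right.
by left; lia.
Qed.

Lemma cdfN1 P : cdf P (- 1) = 0.
Proof. by rewrite /cdf (_ : [set _ | _] = set0) ?measure0// -subset0. Qed.

Section fixed.
Context {Q Qt : probability nat R} (hQt : is_least_concave_majorant Q Qt).

(** Concavity at the consecutive points k - 1, k, k + 1; for k = 0 this uses the node -1. *)
Lemma majorant_mass_nonincreasing : decreasing_probabilities Qt.
Proof.
move=> k; have [cG _ _] := hQt.
have := cG (k%:Z - 1) k%:Z k.+1%:Z ltac:(lia) ltac:(lia) ltac:(lia).
rewrite (cdf_rec _ k.+1) (cdf_rec _ k).
rewrite (_ : k.+1%:Z - 1 = k); last by lia.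
rewrite (cdf_rec _ k).
rewrite (_ : k.+1%:Z - k%:Z = 1); last by lia.
rewrite (_ : k%:Z - (k%:Z - 1) = 1); last by lia.
rewrite (_ : k.+1%:Z - (k%:Z - 1) = 2); last by lia.
by lra.
Qed.

Lemma cdf_diff_le0 (k : nat) : cdf Q k <= cdf Qt k.
Proof. by have [_ + _] := hQt; apply; lia. Qed.

(* If the majorant were strictly above at a kink, it could be lowered there. *)
Lemma majorant_kink k : mass Qt k.+1 < mass Qt k -> cdf Q k = cdf Qt k.
Proof.
move=> kink; apply/eqP; rewrite eq_le cdf_diff_le0 /= leNgt; apply/negP => lt.
have [cG mG lG] := hQt.
(* The first bound keeps the lowered function above [cdf Q]. The second keeps it concave at [k],
   where lowering by [eps] costs [2 * eps] in the second difference. *)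
pose eps := Num.min (cdf Qt k - cdf Q k) ((mass Qt k - mass Qt k.+1) / 2).
have eps0 : 0 < eps by rewrite lt_min; apply/andP; split; lra.
have eps1 : eps <= cdf Qt k - cdf Q k by rewrite ge_min lexx.
have eps2 : eps <= (mass Qt k - mass Qt k.+1) / 2 by rewrite ge_min lexx orbT.
pose G' (z : int) := if z == k then cdf Qt k - eps else cdf Qt z.
have G'le z : G' z <= cdf Qt z by rewrite /G'; case: eqP => [->|]; lra.
suff cG' : discrete_concave G'.
  have mG' : majorizes G' (cdf Q).
    move=> z z1; rewrite /G'; case: eqP => [->|_]; first lra.
    exact: mG.
  have := lG _ cG' mG' k%:Z ltac:(lia); rewrite /G' eqxx; lra.
move=> a b c a1 ab bc.
(* If the middle point is not [k], only values at the ends can drop, which weakens the inequality to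
   prove. *)
have [bk|bk] := eqVneq b k; last first.
  rewrite {3}/G' (negbTE bk); apply: le_trans (cG _ _ _ a1 ab bc).
  by apply: lerD; apply: ler_wpM2l => //; rewrite ler0z; lia.
rewrite {b}bk in ab bc *.
have [->|ak] := eqVneq a k; first by rewrite subrr mul0r addr0.
have [->|ck] := eqVneq c k; first by rewrite subrr mul0r add0r.
rewrite /G' (negbTE ak) (negbTE ck) eqxx.
(* These bound [cdf Qt] at [a] and [c] by the lines through its value at [k] with slopes [mass Qt k]
   and [mass Qt k.+1]. *)
have h1 := cG a (k%:Z - 1) k%:Z a1 ltac:(lia) ltac:(lia).
have h2 := cG k%:Z k.+1%:Z c ltac:(lia) ltac:(lia) ltac:(lia).
have e1 := cdf_rec Qt k.
have := cdf_rec Qt k.+1.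
rewrite (_ : k.+1%:Z - 1 = k); last by lia.
move=> e2; move: h1 h2; rewrite e2.
have -> : cdf Qt (k%:Z - 1) = cdf Qt k - mass Qt k by lra.
have -> : k%:Z - (k%:Z - 1) = 1 by lia.
have -> : k.+1%:Z - k%:Z = 1 by lia.
have -> : (k%:Z - 1 - a)%:~R = (k%:Z - a)%:~R - 1 :> R.
  by rewrite -[1 in RHS](mulr1z 1) -intrB; congr (_%:~R); lia.
have -> : (c - k.+1%:Z)%:~R = (c - k%:Z)%:~R - 1 :> R.
  by rewrite -[1 in RHS](mulr1z 1) -intrB; congr (_%:~R); lia.
have -> : (c - a)%:~R = (c - k%:Z)%:~R + (k%:Z - a)%:~R :> R.
  by rewrite -intrD; congr (_%:~R); lia.
have : 1 <= (c - k%:Z)%:~R :> R by rewrite ler1z; lia.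
have : 1 <= (k%:Z - a)%:~R :> R by rewrite ler1z; lia.
(* Here [x] is c - k and [y] is k - a. Concavity has slack [x * y] times the slope drop, lowering
   costs [(x + y) * eps], and [x + y <= 2 * (x * y)] because both are at least 1. *)
move: (_%:~R) (_%:~R) => x y y1 x1 h1 h2.
have h3 : y * cdf Qt c <= y * (cdf Qt k + x * mass Qt k.+1).
  by apply: ler_wpM2l; lra.
have h4 : x * cdf Qt a <= x * (cdf Qt k - y * mass Qt k).
  by apply: ler_wpM2l; lra.
have h5 : x * y * eps <= x * y * ((mass Qt k - mass Qt k.+1) / 2).
  by apply: ler_wpM2l => //; nra.
have : (x + y) * eps <= 2 * (x * y) * eps by apply: ler_wpM2r; nra.
lra.
Qed.

(** Induction from the common value 0 at -1. If the preceding mass is positive, the slope drops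
    there and the kink lemma applies; if it is 0, the majorant is flat and [cdf Q], nondecreasing
    and below it, stays in contact. *)
Lemma majorant_mass0_touch (k : nat) : mass Qt k = 0 ->
  cdf Q (k%:Z - 1) = cdf Qt (k%:Z - 1).
Proof.
elim: k => [_|k IH pk1]; first by rewrite !cdfN1.
rewrite (_ : k.+1%:Z - 1 = k); last by lia.
have [pk|pk] := eqVneq (mass Qt k) 0; last first.
  by apply: majorant_kink; rewrite pk1 lt_def pk mass_ge0.
have := cdf_diff_le0 k; have := IH pk; rewrite !cdf_rec pk.
have := mass_ge0 Q k; lra.
Qed.

(** Absolute continuity of [Q] with respect to [Qt]: starting from contact at k - 1, [cdf Q] cannot
    rise above the flat majorant. *)
Lemma majorant_mass0 k : mass Qt k = 0 -> mass Q k = 0.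
Proof.
move=> pk; have := majorant_mass0_touch pk; have := cdf_diff_le0 k.
rewrite !cdf_rec pk; have := mass_ge0 Q k; lra.
Qed.

(* Summation by parts: 1 / mass Qt only jumps at indices where both CDFs
   agree. *)
Lemma sum_likelihood_ratio_eq k : 0 < mass Qt k ->
  \sum_(j < k.+1) (mass Q j / mass Qt j - 1) = (cdf Q k - cdf Qt k) / mass Qt k.
Proof.
elim: k => [|k IH] pk.
  by rewrite big_ord1 /= !cdf_rec !cdfN1 !add0r mulrBl divff// gt_eqF.
have le := majorant_mass_nonincreasing k.
have pk' : 0 < mass Qt k := lt_le_trans pk le.
rewrite big_ord_recr/= IH// !(cdf_rec _ k.+1).
rewrite (_ : k.+1%:Z - 1 = k); last by lia.
have -> : (cdf Q k - cdf Qt k) / mass Qt k =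
          (cdf Q k - cdf Qt k) / mass Qt k.+1.
  move: le; rewrite le_eqVlt => /orP[/eqP ->//|kink].
  by rewrite majorant_kink// subrr !mul0r.
by field; rewrite gt_eqF.
Qed.

Lemma sum_likelihood_ratio_le k :
  \sum_(j < k) (mass Q j / mass Qt j - 1) <= 0.
Proof.
elim: k => [|k IH]; first by rewrite big_ord0.
have [pk|pk] := eqVneq (mass Qt k) 0.
  (* Division by 0 gives 0, so the new summand is -1. *)
  by rewrite big_ord_recr/= pk invr0 mulr0; lra.
have pk0 : 0 < mass Qt k by rewrite lt_def pk mass_ge0.
rewrite sum_likelihood_ratio_eq// pmulr_lle0 ?invr_gt0// subr_le0.
exact: cdf_diff_le0.
Qed.

End fixed.

(** Abel summation in inductive form: since each partial sum [S] is nonpositive, replacing the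
    weight [f m] by the smaller [f m.+1] can only increase the product with [S]. *)
Lemma sum_nonincreasing_weight (f g : nat -> R) n :
  (forall k, 0 <= f k) -> (forall k, f k.+1 <= f k) ->
  (forall k, \sum_(j < k) (g j - 1) <= 0) ->
  \sum_(k < n) f k * g k <= \sum_(k < n) f k.
Proof.
move=> f0 df sg; pose S k := \sum_(j < k) (g j - 1).
suff h m : \sum_(k < m.+1) f k * (g k - 1) <= f m * S m.+1.
  case: n => [|n]; first by rewrite !big_ord0.
  rewrite -subr_le0 -sumrB.
  under eq_bigr do rewrite -{2}[f _]mulr1 -mulrBr.
  by apply: le_trans (h n) _; rewrite mulr_ge0_le0//; exact: sg.
elim: m => [|m IH]; first by rewrite /S !big_ord1.
have -> : S m.+2 = S m.+1 + (g m.+1 - 1) by rewrite /S [LHS]big_ord_recr.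
rewrite big_ord_recr/= [leRHS]mulrDr lerD2r; apply: le_trans IH _.
by apply: ler_wnM2r => //; exact: sg.
Qed.

End majorant.

(** * Log-optimality and uniqueness of the numeraire *)

Section e_values.
Context d (T : measurableType d) (R : realType).
Implicit Types (A : set {measure set T -> \bar R}) (f g : T -> R).

Lemma measurable_funV_ge0 f : measurable_fun setT f -> (forall x, 0 <= f x) ->
  measurable_fun setT (fun x => (f x)^-1).
Proof.
move=> mf f0.
(* On nonnegative reals the inverse is the power -1, also at 0, where both are 0. *)
rewrite (_ : (fun _ => _) = (@powR R ^~ (-1)) \o f).
  by apply: measurableT_comp => //; exact: measurable_powR.
by apply/funext => x /=; rewrite powR_inv1.
Qed.

Lemma measurable_fun_ratio f g :
  measurable_fun setT f -> measurable_fun setT g -> (forall x, 0 <= g x) ->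
  measurable_fun setT (fun x => f x / g x).
Proof.
by move=> mf mg g0; apply: measurable_funM => //; exact: measurable_funV_ge0.
Qed.

Lemma measurable_fun_log f : measurable_fun setT f ->
  measurable_fun setT (fun x => lne (f x)%:E).
Proof.
move=> mf; apply: measurable_fun_ifT => //.
- by apply: measurable_fun_ler => //; exact: measurable_cst.
- by apply/measurable_EFinP; apply: measurableT_comp => //; exact: measurable_ln.
Qed.

Lemma polarP A f : polar A f <->
  [/\ measurable_fun setT f, (forall x, 0 <= f x) &
     forall P, A P -> (\int[P]_x (f x)%:E <= 1)%E].
Proof.
split => -[mf f0 fA]; split => //.
- by move=> P AP; apply: le_trans fA; apply: ereal_sup_ubound; exists P.
- by apply: ge_ereal_sup => _ [P AP <-]; exact: fA.
Qed.

(** The midpoint of two candidate numeraires is the competitor that forces them to agree. *)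
Lemma polar_midpoint A f g : polar A f -> polar A g ->
  polar A (fun x => (f x + g x) / 2).
Proof.
move=> /polarP[mf f0 fA] /polarP[mg g0 gA]; apply/polarP; split.
- by apply: measurable_funM; [exact: measurable_funD|exact: measurable_cst].
- by move=> x; rewrite divr_ge0 ?addr_ge0.
- move=> P AP.
  under eq_integral do rewrite mulrC EFinM EFinD.
  rewrite ge0_integralZl_EFin ?invr_ge0//; last 2 first.
  + by move=> x _; rewrite adde_ge0 ?lee_fin.
  + by apply: emeasurable_funD; exact/measurable_EFinP.
  rewrite ge0_integralD//; last 4 first.
  + by move=> x _; rewrite lee_fin.
  + exact/measurable_EFinP.
  + by move=> x _; rewrite lee_fin.
  + exact/measurable_EFinP.
  rewrite lee_pdivrMl// mule1 (_ : 2%:E = 1 + 1)%E; last by rewrite -EFinD.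
  by apply: leeD; [exact: fA|exact: gA].
Qed.

Local Arguments lne : simpl never.
Local Notation lnf f := (fun x => lne (f x)%:E).

Section fixed_reference.
Context (Q : {measure set T -> \bar R}).
Hypothesis QT : Q setT = 1%E.

Let integral_pos_ge0 f : (0 <= \int[Q]_x (lnf f)^\+ x)%E.
Proof. exact: integral_ge0. Qed.

Let integral_neg_ge0 f : (0 <= \int[Q]_x (lnf f)^\- x)%E.
Proof. exact: integral_ge0. Qed.

(** The negative part of [log g] is at most [1 / g], because [log (1 / g) < 1 / g]. This keeps
    [elog_mean] out of its default value [-oo]. *)
Lemma integral_negative_log_lty g :
  measurable_fun setT g -> (forall x, 0 <= g x) ->
  {ae Q, forall x, 0 < g x} -> (\int[Q]_x ((g x)^-1)%:E <= 1)%E ->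
  (\int[Q]_x ((lnf g)^\- x) < +oo)%E.
Proof.
move=> mg gge0 g0 gV; apply: (@le_lt_trans _ _ 1%E); last by rewrite ltry.
apply: le_trans gV; apply: ae_ge0_le_integral => //.
- exact/measurable_funeneg/measurable_fun_log.
- by move=> x _; rewrite lee_fin invr_ge0.
- exact/measurable_EFinP/measurable_funV_ge0.
- apply: filterS g0 => x gx _ /=.
  rewrite funenegE lne_EFin// -EFinN -EFin_max lee_fin ge_max invr_ge0 gge0.
  by rewrite andbT -lnV ?posrE// ltW// ln_sublinear// invr_gt0.
Qed.

(* Integrate [log f + 1 <= log g + f / g], with the negative parts moved to
   the other side so that all integrands are nonnegative. *)
Lemma elog_mean_le f g :
  measurable_fun setT f -> measurable_fun setT g ->
  (forall x, 0 <= f x) -> (forall x, 0 <= g x) ->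
  {ae Q, forall x, 0 < g x} -> (\int[Q]_x (f x / g x)%:E <= 1)%E ->
  (\int[Q]_x ((lnf g)^\- x) < +oo)%E ->
  (elog_mean Q f <= elog_mean Q g)%E.
Proof.
move=> mf mg f0 g0 gpos fg gneg; rewrite /elog_mean.
case: ifPn => [_|]; first exact: leNye.
rewrite (lt_eqF gneg) -ltey => fneg.
rewrite [leLHS]integralE [leRHS]integralE.
have mpos (h : T -> R) : measurable_fun setT h -> measurable_fun setT (lnf h)^\+%E.
  by move=> mh; apply: measurable_realfun.measurable_funepos; exact: measurable_fun_log.
have mneg (h : T -> R) : measurable_fun setT h -> measurable_fun setT (lnf h)^\-%E.
  by move=> mh; exact/measurable_funeneg/measurable_fun_log.
have mr : measurable_fun setT (fun x => (f x / g x)%:E).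
  exact/measurable_EFinP/measurable_fun_ratio.
have : (\int[Q]_x (((lnf f)^\+ x + (lnf g)^\- x) + 1) <=
    \int[Q]_x (((lnf f)^\- x + (lnf g)^\+ x) + (f x / g x)%:E))%E.
  apply: ae_ge0_le_integral => //.
  - by move=> x _; rewrite !adde_ge0.
  - apply: emeasurable_funD; last exact: measurable_cst.
    by apply: emeasurable_funD; [exact: mpos|exact: mneg].
  - by move=> x _; rewrite !adde_ge0// lee_fin divr_ge0.
  - apply: emeasurable_funD => //.
    by apply: emeasurable_funD; [exact: mneg|exact: mpos].
  apply: filterS gpos => x gx _ /=.
  rewrite !funeposE !funenegE (lne_EFin gx).
  (* Where [f] vanishes, the negative part of its logarithm is [+oo] and sits on the larger side. *)
  have [fx0|fx] := eqVneq (f x) 0.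
    by rewrite fx0 le0_lneNy//= maxye -!EFin_max !addye// leey.
  have fx' : 0 < f x by rewrite lt_def fx f0.
  rewrite lne_EFin// -!EFinN -!EFin_max -!EFinD lee_fin.
  have h : ln (f x) - ln (g x) <= f x / g x - 1.
    rewrite -ln_div ?posrE//.
    rewrite {1}(_ : f x / g x = 1 + (f x / g x - 1)); last by ring.
    by apply: le_ln1Dx; rewrite ltrBrDl subrr divr_gt0.
  move: (ln (f x)) (ln (g x)) (f x / g x) h => a b c h.
  by rewrite /Num.max; case: ltP => ?; case: ltP => ?; case: ltP => ?; case: ltP => ?; lra.
have m1 : measurable_fun [set: T] (fun=> 1%E : \bar R) by exact: measurable_cst.
rewrite !ge0_integralD//; try by [exact: mpos | exact: mneg
  | apply: emeasurable_funD; [exact: mpos|exact: mneg]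
  | apply: emeasurable_funD; [exact: mneg|exact: mpos]
  | move=> x _; rewrite ?adde_ge0// lee_fin divr_ge0].
(* The bound [fg] cancels the constant 1. Both negative parts have finite integrals, so the terms
   can be moved back in the extended reals. *)
rewrite integral_cst// QT mule1 => /le_trans/(_ (leeD2l _ fg)).
move: (integral_pos_ge0 f) (integral_neg_ge0 f) fneg.
move: (integral_pos_ge0 g) (integral_neg_ge0 g) gneg.
move: (\int[Q]_x (lnf f)^\+ x)%E (\int[Q]_x (lnf f)^\- x)%E.
move: (\int[Q]_x (lnf g)^\+ x)%E (\int[Q]_x (lnf g)^\- x)%E.
move=> [a||] [b||] [c||] [e||]//= _ _ _ _ _ _; rewrite ?addye ?leey//.
by rewrite -!EFinD !lee_fin; lra.
Qed.

(* With [r = g / f], the elementary bound [log u >= 1 - 1 / u] at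
   [u = (1 / r + 1) / 2] gives
   [(r - 1)^2 / (2 (1 + r)) <= (r - 1) / 2 + log u]; the left-hand side is
   therefore a nonnegative function with nonpositive integral. *)
Lemma ae_eq_of_midpoint f g :
  measurable_fun setT f -> measurable_fun setT g ->
  (forall x, 0 <= f x) -> (forall x, 0 <= g x) ->
  {ae Q, forall x, 0 < f x} -> {ae Q, forall x, 0 < g x} ->
  (\int[Q]_x (g x / f x)%:E <= 1)%E ->
  (elog_mean Q (fun x => (f x + g x) / 2 / g x)%R <= 0)%E ->
  {ae Q, forall x, g x = f x}.
Proof.
move=> mf mg f0 g0 fpos gpos gf.
set u := fun x => (f x + g x) / 2 / g x.
pose r x := g x / f x.
have r0 x : 0 <= r x by rewrite /r divr_ge0.
have mr : measurable_fun setT r by exact: measurable_fun_ratio.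
pose h x := (r x - 1) ^+ 2 / (2 * (1 + r x)).
have h0 x : 0 <= h x by rewrite /h divr_ge0 ?sqr_ge0// mulr_ge0// addr_ge0.
have mh : measurable_fun setT h.
  apply: measurable_fun_ratio.
  - by apply: measurable_funX; exact: measurable_funB.
  - by apply: measurable_funM => //; exact: measurable_funD.
  - by move=> x; rewrite mulr_ge0// addr_ge0.
have mu : measurable_fun setT u.
  apply: measurable_fun_ratio => //.
  by apply: measurable_funM => //; exact: measurable_funD.
have mpos : measurable_fun setT (lnf u)^\+%E.
  by apply: measurable_funepos; exact: measurable_fun_log.
have mneg : measurable_fun setT (lnf u)^\-%E.
  by apply: measurable_funeneg; exact: measurable_fun_log.
have uE : {ae Q, forall x, u x = (1 + r x) / (2 * r x) /\ 0 < r x}.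
  apply: filterS2 fpos gpos => x fx gx; split; last by rewrite divr_gt0.
  by rewrite /u /r; field; rewrite !gt_eqF.
have rE x : r x = g x / f x by [].
have hE x : h x = (r x - 1) ^+ 2 / (2 * (1 + r x)) by [].
clearbody r h.
have uneg : (\int[Q]_x (lnf u)^\- x < +oo)%E.
  (* [u] is half of [1 + f / g], hence at least 1/2 almost everywhere, so the negative part of its
     logarithm is at most [ln 2]. *)
  apply: (@le_lt_trans _ _ (\int[Q]_x (ln 2)%:E)%E); last first.
    by rewrite integral_cst// QT mule1 ltry.
  apply: ae_ge0_le_integral => //.
  - by move=> x _; rewrite lee_fin ln_ge0// ler1n.
  apply: filterS uE => x [ux rx] _.
  have u1 : 1 / 2 <= u x by rewrite ux ler_pdivlMr ?mulr_gt0//; lra.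
  rewrite funenegE lne_EFin; last by lra.
  rewrite -EFinN -EFin_max lee_fin ge_max ln_ge0 ?ler1n// andbT.
  rewrite -lnV ?posrE; last by lra.
  rewrite ler_ln ?posrE ?invr_gt0//; last by lra.
  by rewrite -[leRHS]invrK lef_pV2 ?posrE; lra.
rewrite /elog_mean (lt_eqF uneg) integralE => upos.
have {}upos : (\int[Q]_x (lnf u)^\+ x <= \int[Q]_x (lnf u)^\- x)%E.
  by move: upos; rewrite leeBlDr ?add0e// ge0_fin_numE.
have : (\int[Q]_x ((h x)%:E + (2^-1)%:E + (lnf u)^\- x) <=
        \int[Q]_x ((2^-1)%:E * (r x)%:E + (lnf u)^\+ x))%E.
  apply: ae_ge0_le_integral => //.
  - by move=> x _; rewrite !adde_ge0// lee_fin ?invr_ge0.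
  - by apply: emeasurable_funD => //; apply: emeasurable_funD => //; exact/measurable_EFinP.
  - by move=> x _; rewrite adde_ge0// -EFinM lee_fin mulr_ge0 ?invr_ge0.
  - apply: emeasurable_funD => //; apply: measurable_funeM.
    exact/measurable_EFinP.
  apply: filterS uE => x [ux rx] _.
  have ux0 : 0 < u x by rewrite ux divr_gt0 ?mulr_gt0//; lra.
  rewrite funeposE funenegE lne_EFin// -EFinN -!EFin_max -EFinM -!EFinD lee_fin.
  have : 1 - (u x)^-1 <= ln (u x).
    have := @le_ln1Dx R ((u x)^-1 - 1).
    rewrite (_ : 1 + ((u x)^-1 - 1) = (u x)^-1); last by ring.
    rewrite lnV ?posrE// ltrBrDl subrr invr_gt0 => /(_ ux0); lra.
  have -> : 1 - (u x)^-1 = h x + 2^-1 - 2^-1 * r x.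
    by rewrite ux hE; field; rewrite !gt_eqF//; lra.
  move: (ln (u x)) (h x) => a b.
  by rewrite /Num.max; case: ltP => ?; case: ltP => ?; lra.
rewrite !ge0_integralD//; try by [exact/measurable_EFinP
  | move=> x _; rewrite ?adde_ge0// -?EFinM lee_fin ?mulr_ge0 ?invr_ge0
  | apply: emeasurable_funD => //; exact/measurable_EFinP
  | apply: measurable_funeM; exact/measurable_EFinP].
rewrite integral_cst// QT mule1 ge0_integralZl_EFin//; last 2 first.
- by move=> x _; rewrite lee_fin.
- exact/measurable_EFinP.
have : ((2^-1)%:E * \int[Q]_x (r x)%:E <= (2^-1)%:E)%E.
  by under eq_integral do rewrite rE; rewrite lee_pdivrMl// -EFinM divff.
move=> rle ineq.
have {ineq rle} : (\int[Q]_x (h x)%:E <= 0)%E.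
  move: (le_trans ineq (leeD rle upos)).
  have : (0 <= \int[Q]_x (lnf u)^\- x)%E by [].
  move: uneg; case: (\int[Q]_x (lnf u)^\- x)%E => [b||]// _ _.
  have : (0 <= \int[Q]_x (h x)%:E)%E by apply: integral_ge0 => x _; rewrite lee_fin.
  case: (\int[Q]_x (h x)%:E)%E => [c||]// _.
  by rewrite -!EFinD !lee_fin; lra.
rewrite le_eqVlt ltNge integral_ge0 ?orbF; last by move=> x _; rewrite lee_fin.
move=> /eqP hI.
have /(ae_eq_integral_abs Q measurableT) : measurable_fun setT (EFin \o h).
  exact/measurable_EFinP.
move=> [+ _] => /(_ _)/wrap[].
  rewrite -[RHS]hI; apply: eq_integral => x _.
  by rewrite /= ger0_norm.
move=> hae; apply: filterS3 fpos uE hae => x fx [_ rx] /(_ I) /= [].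
(* Either [r x] is 1 or the denominator of [h] is 0; positivity of [r x] excludes the latter. *)
move=> /eqP; rewrite hE mulf_eq0 invr_eq0 sqrf_eq0 subr_eq0 => /orP[/eqP r1|].
  by rewrite -[RHS]mul1r -r1 rE divfK// gt_eqF.
by rewrite gt_eqF//; lra.
Qed.

End fixed_reference.

Section numeraire.
Context A (Q : {measure set T -> \bar R}) (E : T -> R).
Hypotheses (QT : Q setT = 1%E) (polE : polar A E).
Hypothesis Epos : {ae Q, forall x, 0 < E x}.
Hypothesis ratio_le1 :
  forall F, polar A F -> (\int[Q]_x (F x / E x)%:E <= 1)%E.

(** Comparison of [F / E] with the constant 1, whose logarithm has mean 0. *)
Let elog_ratio_le0 F : polar A F -> (elog_mean Q (fun x => F x / E x)%R <= 0)%E.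
Proof.
move=> pF; have [mE E0 _] := polE; have [mF F0 _] := pF.
have log1 : (fun x : T => lne ((1 : R)%:E)) = (fun=> 0%E).
  by apply/funext => x; rewrite lne1.
have neg1 : (\int[Q]_x ((fun _ : T => 0 : \bar R)^\- x) = 0)%E.
  by apply: integral0_eq => x _; rewrite funenegE oppe0 maxxx.
have <- : elog_mean Q (fun=> 1) = 0%E.
  by rewrite /elog_mean log1 neg1 integral0.
apply: elog_mean_le => //.
- exact: measurable_fun_ratio.
- by move=> x; rewrite divr_ge0.
- exact: aeW.
- by under eq_integral do rewrite divr1; exact: ratio_le1.
- by rewrite log1 neg1.
Qed.

(** For uniqueness, a second numeraire [E'] is tested against the midpoint of [E] and [E'], while
    the ratio bound is applied to [E' / E]. *)
Lemma numeraire_of_ratio_le1 : is_numeraire A Q E.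
Proof.
split; first by split.
move=> E' [pE' E'pos E'opt]; have [mE E0 _] := polE; have [mE' E'0 _] := pE'.
apply: ae_eq_of_midpoint => //; first exact: ratio_le1.
by apply: E'opt; exact: polar_midpoint.
Qed.

(** The constant e-value 1 in the ratio bound gives that [1 / E] has integral at most 1, which
    controls the negative part of [log E]. *)
Lemma log_optimal_of_ratio_le1 F :
  polar A (fun=> 1) -> polar A F -> (elog_mean Q F <= elog_mean Q E)%E.
Proof.
move=> p1 pF; have [mE E0 _] := polE; have [mF F0 _] := pF.
apply: elog_mean_le => //; first exact: ratio_le1.
apply: integral_negative_log_lty => //.
by have := ratio_le1 p1; under eq_integral do rewrite div1r.
Qed.

End numeraire.
End e_values.

(** * Integration on countable spaces and product measures *)

Section countable_integration.
Context d (T : measurableType d) (R : realType) (rank : T -> nat).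
Hypothesis rank_inj : injective rank.
Hypothesis measurable1 : forall x : T, measurable [set x].

Lemma measurable_of_injection (B : set T) : measurable B.
Proof.
apply: countable_measurable => //; apply/countable_injP; exists rank.
by move=> x y _ _; exact: rank_inj.
Qed.

Lemma integral_fibers (mu : {measure set T -> \bar R}) D (f : T -> \bar R) :
  (forall x, (0 <= f x)%E) ->
  (\int[mu]_(x in D) f x =
   \sum_(0 <= k <oo) \int[mu]_(x in D `&` rank @^-1` [set k]) f x)%E.
Proof.
move=> f0; rewrite -ge0_integral_bigcup//.
- by congr (integral _ _ _); apply/seteqP; split=> [x Dx|x [k _ []]//]; exists (rank x).
- by move=> k; exact: measurable_of_injection.
- by move=> ? B ?; exact: measurable_of_injection.
- by apply/trivIsetP => i j _ _ ij; apply/seteqP; split => // x [[_ /= xi] [_ /= xj]]; case/eqP: ij; rewrite -xi.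
Qed.

Lemma integral_singleton (mu : {measure set T -> \bar R}) (f : T -> \bar R) x :
  (\int[mu]_(y in [set x]) f y = f x * mu [set x])%E.
Proof.
rewrite -integral_cst//; apply: eq_integral => y.
by rewrite inE => ->.
Qed.

(** Each fiber of [rank] is empty or a single point, so integrals against two different measures can
    be compared atom by atom. *)
Lemma le_integral_singletons (mu nu : {measure set T -> \bar R}) D
    (f g : T -> \bar R) :
  (forall x, (0 <= f x)%E) -> (forall x, (0 <= g x)%E) ->
  (forall x, D x -> (f x * mu [set x] <= g x * nu [set x])%E) ->
  (\int[mu]_(x in D) f x <= \int[nu]_(x in D) g x)%E.
Proof.
move=> f0 g0 fg; rewrite (integral_fibers mu)// (integral_fibers nu)//.
apply: lee_nneseries => [k _ _|k _]; first exact: integral_ge0.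
have [[x [Dx xk]]|nx] := pselect (exists x, D x /\ rank x = k).
  rewrite (_ : D `&` _ = [set x]) ?integral_singleton ?fg//.
  apply/seteqP; split=> [y [_ yk]|_ ->]//; apply: rank_inj.
  by rewrite xk.
by rewrite (_ : D `&` _ = set0) ?integral_set0//; apply/seteqP; split=> // x [Dx xk]; apply: nx; exists x.
Qed.

Lemma eq_integral_singletons (mu nu : {measure set T -> \bar R}) D
    (f g : T -> \bar R) :
  (forall x, (0 <= f x)%E) -> (forall x, (0 <= g x)%E) ->
  (forall x, D x -> (f x * mu [set x] = g x * nu [set x])%E) ->
  (\int[mu]_(x in D) f x = \int[nu]_(x in D) g x)%E.
Proof.
move=> f0 g0 fg; apply/eqP; rewrite eq_le; apply/andP.
by split; apply: le_integral_singletons => // x Dx; rewrite fg.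
Qed.

End countable_integration.

(** * Product powers: atoms and integrals of product functions *)

Section power_measure.
Context d (T : measurableType d) (R : realType).

Lemma power_measure_setT (mu : {finite_measure set T -> \bar R}) n :
  mu setT = 1%E -> power_measure mu n setT = 1%E.
Proof.
move=> mu1; rewrite -[RHS](@big1 _ _ mule _ (index_enum 'I_n) xpredT (fun=> mu setT))//.
rewrite -power_measure_box//; congr (_ _).
by apply/seteqP; split.
Qed.

Lemma measurable_tuple_set1 n (x : n.-tuple T) :
  (forall t : T, measurable [set t]) -> measurable [set x].
Proof.
move=> m1; rewrite [X in measurable X](_ : _ =
    \bigcap_(i in [set: 'I_n]) ((@tnth n T)^~ i @^-1` [set tnth x i])).
  apply: fin_bigcap_measurable => // i _.
  by rewrite -[X in measurable X]setTI; apply: measurable_tnth.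
apply/seteqP; split=> [_ -> i //|y xy].
by apply: eq_from_tnth => i; exact: xy.
Qed.

Lemma power_measure_set1 (mu : {finite_measure set T -> \bar R}) n
    (x : n.-tuple T) : (forall t : T, measurable [set t]) ->
  power_measure mu n [set x] = (\prod_(i < n) mu [set tnth x i])%E.
Proof.
move=> m1; rewrite -power_measure_box//; congr (_ _).
apply/seteqP; split=> [_ -> i //|y xy].
by apply: eq_from_tnth => i; exact: xy.
Qed.

Lemma measurable_fun_tuple_prod n (f : T -> R) : measurable_fun setT f ->
  measurable_fun setT (fun x : n.-tuple T => \prod_(i < n) f (tnth x i)).
Proof.
move=> mf; apply: measurable_prod => i _.
by apply: measurableT_comp => //; exact: measurable_tnth.
Qed.

(** Induction on [n]: a change of variables along [tuple_cons] gives a double integral, from which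
    Tonelli splits off the first factor. *)
Lemma integral_power_measure_prod (mu : {finite_measure set T -> \bar R}) n
    (f : T -> R) : measurable_fun setT f -> (forall x, 0 <= f x) ->
  (\int[power_measure mu n]_x (\prod_(i < n) f (tnth x i))%R%:E =
   (\int[mu]_x (f x)%:E) ^+ n)%E.
Proof.
move=> mf f0; elim: n => [|n IH].
  rewrite /= integral_dirac//; last first.
    by apply/measurable_EFinP; exact: (measurable_fun_tuple_prod mf).
  by rewrite diracT mul1e big_ord0.
rewrite expeS -IH /= /cons_measure ge0_integral_pushforward//; last 3 first.
- exact: measurable_tuple_cons.
- by apply/measurable_EFinP; exact: (measurable_fun_tuple_prod mf).
- by move=> x _; rewrite lee_fin prodr_ge0.
rewrite preimage_setT fubini_tonelli1; last 2 first.
- apply: (@measurableT_comp _ _ _ _ _ _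
    (fun x : n.+1.-tuple T => (\prod_(i < n.+1) f (tnth x i))%:E)).
    by apply/measurable_EFinP; exact: (measurable_fun_tuple_prod mf).
  exact: measurable_tuple_cons.
- by move=> x; rewrite lee_fin prodr_ge0.
rewrite muleC -ge0_integralZl//; last 3 first.
- exact/measurable_EFinP.
- by move=> x _; rewrite lee_fin.
- by apply: integral_ge0 => x _; rewrite lee_fin prodr_ge0.
apply: eq_integral => x _; rewrite /fubini_F muleC -ge0_integralZl//; last 3 first.
- by apply/measurable_EFinP; exact: (measurable_fun_tuple_prod mf).
- by move=> t _; rewrite lee_fin prodr_ge0.
- by rewrite lee_fin.
apply: eq_integral => t _; rewrite /= big_ord_recl /tuple_cons /= EFinM.
by congr (_ * (_)%:E)%E; apply: eq_bigr => i _; rewrite tnthS.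
Qed.

End power_measure.

(** * The likelihood ratio under a nonincreasing mass function *)

Section monotone_mass.
Context (R : realType).
Implicit Types P Q Qt : probability nat R.

Lemma sum_mass_le1 P k : \sum_(j < k) mass P j <= 1.
Proof.
case: k => [|k]; first by rewrite big_ord0.
suff -> : \sum_(j < k.+1) mass P j = cdf P k.
  by rewrite /cdf -lee_fin fineK ?fin_num_measure// probability_le1.
elim: k => [|k IH]; first by rewrite big_ord1 cdf_rec cdfN1 add0r.
rewrite big_ord_recr/= IH (cdf_rec _ k.+1); congr (cdf _ _ + _); lia.
Qed.

(** The integral is a series whose partial sums are bounded by those of [mass P]; monotonicity of
    [P] enters as the weight in the Abel summation. *)
Lemma integral_likelihood_ratio_le1 Q Qt P :
  is_least_concave_majorant Q Qt -> decreasing_probabilities P ->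
  (\int[P]_k (mass Q k / mass Qt k)%:E <= 1)%E.
Proof.
move=> hQt dP.
have e0 k : 0 <= mass Q k / mass Qt k by rewrite divr_ge0 ?mass_ge0.
rewrite (integral_fibers (rank := id))//.
under eq_eseriesr.
  move=> k _; rewrite setTI preimage_id integral_singleton//.
  rewrite [X in (_ * X)%E](_ : _ = (mass P k)%:E); last by rewrite mass_EFin.
  rewrite -EFinM mulrC; over.
apply: lime_le.
  by apply: is_cvg_nneseries => k _ _; rewrite lee_fin mulr_ge0 ?mass_ge0.
apply: nearW => k; rewrite sumEFin big_mkord lee_fin.
apply: le_trans (sum_mass_le1 P k).
apply: (@sum_nonincreasing_weight _ (mass P) (fun k => mass Q k / mass Qt k)) => //.
- exact: mass_ge0.
- exact: sum_likelihood_ratio_le.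
Qed.

End monotone_mass.

(** * The projection onto products of decreasing distributions *)

Lemma power_measure_mass (R : realType)
    (mu : {finite_measure set nat -> \bar R}) n (x : n.-tuple nat) :
  (power_measure mu n : {measure set (n.-tuple nat) -> \bar R}) [set x] =
    (\prod_(i < n) mass mu (tnth x i))%:E.
Proof.
rewrite [LHS]power_measure_set1// -prodEFin; apply: eq_bigr => i _.
by rewrite /mass fineK// fin_num_measure.
Qed.

Section iid_projection.
Context {R : realType} {Q Qt : probability nat R} {n : nat}.
Hypothesis hQt : is_least_concave_majorant Q Qt.

Let qE (x : n.-tuple nat) :
  (power_measure Q n : {measure set (n.-tuple nat) -> \bar R}) [set x] =
    (\prod_(i < n) mass Q (tnth x i))%:E.
Proof. exact: power_measure_mass. Qed.

Let pE (x : n.-tuple nat) :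
  (power_measure Qt n : {measure set (n.-tuple nat) -> \bar R}) [set x] =
    (\prod_(i < n) mass Qt (tnth x i))%:E.
Proof. exact: power_measure_mass. Qed.

Let rank_inj : injective (pickle : n.-tuple nat -> nat).
Proof. exact: pcan_inj pickleK. Qed.

Let measurable1 (x : n.-tuple nat) : measurable [set x].
Proof. exact: measurable_tuple_set1. Qed.

Lemma optimal_evalue_ge0 (x : n.-tuple nat) : 0 <= optimal_evalue Q Qt x.
Proof. by apply: prodr_ge0 => i _; rewrite divr_ge0 ?mass_ge0. Qed.

Lemma majorant_power_decreasing_iid : decreasing_iid R n (power_measure Qt n).
Proof. by exists Qt => //; exact: majorant_mass_nonincreasing hQt. Qed.

Lemma optimal_evalue_polar : polar (decreasing_iid R n) (@optimal_evalue R Q Qt n).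
Proof.
apply/polarP; split; [|exact: optimal_evalue_ge0|].
  by apply: (measurable_fun_tuple_prod (f := fun k => mass Q k / mass Qt k)).
move=> _ [P dP <-].
rewrite (@integral_power_measure_prod _ _ _ P n (fun k => mass Q k / mass Qt k))//; last first.
  by move=> k; rewrite divr_ge0 ?mass_ge0.
have := integral_likelihood_ratio_le1 hQt dP.
have : (0 <= \int[P]_k (mass Q k / mass Qt k)%:E)%E.
  by apply: integral_ge0 => k _; rewrite lee_fin divr_ge0 ?mass_ge0.
case: (\int[P]_k (mass Q k / mass Qt k)%:E)%E => [r||]//.
by rewrite -EFin_expe !lee_fin => r0 r1; exact: exprn_ile1.
Qed.

(** By absolute continuity a factor can vanish only where [mass Q] does, so every tuple in the
    exceptional set is a null atom of the power of [Q]. *)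
Lemma optimal_evalue_gt0 :
  {ae power_measure Q n, forall x, 0 < optimal_evalue Q Qt x}.
Proof.
pose N := [set x : n.-tuple nat | ~ 0 < optimal_evalue Q Qt x].
have mN : measurable N by exact: measurable_of_injection rank_inj measurable1 _.
exists N; split => //; apply/eqP; rewrite -measure_le0 -[leLHS]mul1e.
rewrite -integral_cst//.
rewrite -(integral0 (power_measure Q n) N).
apply: (le_integral_singletons rank_inj measurable1) => // x /negP Nx.
rewrite mul0e mul1e qE lee_fin.
have [i /eqP] : exists i, mass Q (tnth x i) == 0.
  apply/existsP; apply: contraNT Nx; rewrite negb_exists => /forallP q0.
  apply: prodr_gt0 => i _; rewrite divr_gt0// lt_def mass_ge0 andbT//.
  by apply: contra (q0 i) => /eqP p0; rewrite (majorant_mass0 hQt).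
by move=> qi; rewrite (bigD1 i)//= qi mul0r.
Qed.

Lemma ratio_optimal_evalue_le1 E : polar (decreasing_iid R n) E ->
  (\int[power_measure Q n]_x (E x / optimal_evalue Q Qt x)%:E <= 1)%E.
Proof.
move=> /polarP[_ E0 /(_ _ majorant_power_decreasing_iid)]; apply: le_trans.
apply: (le_integral_singletons rank_inj measurable1) => x.
- by rewrite lee_fin divr_ge0 ?optimal_evalue_ge0.
- by rewrite lee_fin.
move=> _; rewrite qE pE -!EFinM lee_fin -mulrA ler_wpM2l// -prodfV -big_split/=.
apply: ler_prod => i _; rewrite invfM invrK.
have q0 := mass_ge0 Q (tnth x i); have p0 := mass_ge0 Qt (tnth x i).
rewrite !mulr_ge0 ?invr_ge0//=.
(* The factor [q * (p / q)] is [p] if [q] is nonzero and 0 otherwise; mass of [Qt] off the atoms of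
   [Q] is lost, hence an inequality. *)
have [->|qi] := eqVneq (mass Q (tnth x i)) 0; first by rewrite mulr0.
by rewrite mulrC mulrA divff// mul1r.
Qed.

(** The same factorwise computation, now an equality: the indicator in [ac_part] removes exactly the
    atoms where [mass Q] is 0, and there the inverse of 0 is 0. *)
Lemma power_ac_part_density (B : set (n.-tuple nat)) : measurable B ->
  (power_measure (ac_part Q Qt) n B =
   \int[power_measure Q n]_(x in B) ((optimal_evalue Q Qt x)^-1)%:E)%E.
Proof.
move=> mB; rewrite -[LHS]mul1e -integral_cst//.
apply: (eq_integral_singletons rank_inj measurable1) => x //.
- by rewrite lee_fin invr_ge0 optimal_evalue_ge0.
move=> _; rewrite mul1e power_measure_mass qE -EFinM -prodfV -big_split/=.
congr (_%:E); apply: eq_bigr => i _; rewrite mass_ac_part invfM invrK.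
have [->|qi] := eqVneq (mass Q (tnth x i)) 0; first by rewrite ltxx !mulr0.
by rewrite lt_def qi mass_ge0 mulr1 mulrC mulrA divff// mul1r.
Qed.

Lemma decreasing_iid_dominates :
  dominated_by (decreasing_iid R n) (power_measure Q n).
Proof.
move=> N mN /(_ _ majorant_power_decreasing_iid) N0.
apply/eqP; rewrite -measure_le0 -[leLHS]mul1e -integral_cst//.
(* Writing 0 as the integral of [+oo] over a null set makes the atomwise comparison trivial wherever
   [Qt] has positive mass. *)
rewrite -[leRHS](mule0 +oo%E) -N0 -integral_cst//.
apply: (le_integral_singletons rank_inj measurable1) => // [x|x _].
  exact: leey.
rewrite mul1e qE pE.
have [p0|p0] := eqVneq (\prod_(i < n) mass Qt (tnth x i)) 0; last first.
  by rewrite gt0_mulye ?leey// lte_fin lt_def p0 prodr_ge0// => i _; exact: mass_ge0.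
rewrite p0 mule0 lee_fin.
move/eqP/prodf_eq0: p0 => [i _ /eqP pi].
by rewrite (bigD1 i)//= (majorant_mass0 hQt pi) mul0r.
Qed.

Lemma one_polar : polar (decreasing_iid R n) (fun=> 1).
Proof.
apply/polarP; split=> // _ [P _ <-].
rewrite integral_cst// mul1e [leLHS]power_measure_setT//.
exact: probability_setT.
Qed.

End iid_projection.

Theorem corollary3p13 (R : realType) (Q Qt : probability nat R) (n : nat)
    (hQt : is_least_concave_majorant Q Qt) (hn : (1 <= n)%N) :
  [/\ is_reverse_information_projection (decreasing_iid R n)
        (power_measure Q n) (power_measure (ac_part Q Qt) n),
      polar (decreasing_iid R n) (@optimal_evalue R Q Qt n) &
      forall E : n.-tuple nat -> R, polar (decreasing_iid R n) E ->
        (elog_mean (power_measure Q n) E <=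
         elog_mean (power_measure Q n) (@optimal_evalue R Q Qt n))%E].
Proof.
have QnT : power_measure Q n setT = 1%E.
  by apply: power_measure_setT; exact: probability_setT.
have pE := optimal_evalue_polar (n := n) hQt.
have Epos := optimal_evalue_gt0 (n := n) hQt.
have ratio := @ratio_optimal_evalue_le1 _ _ _ n hQt.
split => //; last by move=> E; apply: log_optimal_of_ratio_le1 => //; exact: one_polar.
split; first exact: decreasing_iid_dominates hQt.
exists (@optimal_evalue R Q Qt n); first exact: numeraire_of_ratio_le1.
by move=> B; exact: power_ac_part_density.
Qed.
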